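(* Let $k$ be an analytic tridiagonal kernel corresponding to the orthonormal basis $\{f_n\}_{n\ge 0}$ of $\mathcal{H}_k$, where $f_n(z)=(a_n+b_nz)z^n$, $n\ge 0$. For $n\ge 1$ put $d_n=\frac{b_n}{a_n}-\frac{b_{n-1}}{a_{n-1}}$. Then the linear operator $L$ whose matrix $(\ell_{mn})_{m,n\ge 0}$, $\ell_{mn}=\langle Lf_n,f_m\rangle$, with respect to the orthonormal basis $\{f_n\}_{n\ge 0}$ is $$\ell_{mn}=\begin{cases}\dfrac{a_{m+1}}{a_m} & n=m+1,\\[2mm] d_m & n=m\ge 1,\\[1mm] (-1)^{m-n}\,\dfrac{d_n\,b_nb_{n+1}\cdots b_{m-1}}{a_{n+1}a_{n+2}\cdots a_m} & 1\le n<m,\\[2mm] 0 & \text{otherwise,}\end{cases}$$ i.e. $$[L]=\begin{bmatrix}0&\frac{a_1}{a_0}&0&0&\cdots\\ 0&d_1&\frac{a_2}{a_1}&0&\cdots\\ 0&\frac{-d_1b_1}{a_2}&d_2&\frac{a_3}{a_2}&\cdots\\ 0&\frac{d_1b_1b_2}{a_2a_3}&\frac{-d_2b_2}{a_3}&d_3&\cdots\\ \vdots&\vdots&\vdots&\vdots&\ddots\end{bmatrix},$$ defines a bounded linear operator on $\mathcal{H}_k$.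
   Context: $\mathbb{D}$ is the open unit disc, $\mathcal{O}(\mathbb{D})$ the space of analytic functions on $\mathbb{D}$. For a positive definite scalar kernel $k$ on $\mathbb{D}$, analytic in the first variable, $\mathcal{H}_k$ is its reproducing kernel Hilbert space of analytic functions. A semi-analytic tridiagonal space is such an $\mathcal{H}_k$ with $\mathbb{C}[z]\subseteq\mathcal{H}_k\subseteq\mathcal{O}(\mathbb{D})$ for which there are complex scalars $\{a_n\}_{n\ge 0}$, $\{b_n\}_{n\ge 0}$ with $a_n\ne 0$ for all $n$, $\sup_{n}|a_n/a_{n+1}|<\infty$, $\limsup_{n}|b_n/a_{n+1}|<1$, and such that $f_n(z)=(a_n+b_nz)z^n$, $n\ge 0$, form an orthonormal basis of $\mathcal{H}_k$ (so $k(z,w)=\sum_{n\ge0}f_n(z)\overline{f_n(w)}$). It is an analytic tridiagonal space (and $k$ an analytic tridiagonal kernel) if in addition $\{|a_n/a_{n+1}|\}_{n\ge 0}$ is bounded away from zero. *)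

(* Defs.v *)
From Stdlib Require Import Reals List.
From Coquelicot Require Import Coquelicot.

Open Scope C_scope.

Definition unit_disc (z : C) : Prop := (Cmod z < 1)%R.

(* Functions on the disc are total functions [C -> C] whose values outside
   [unit_disc] are never used; the disc is open, so [ex_derive] at one of its points
   does not depend on them. *)
Definition analytic_on_disc (g : C -> C) : Prop :=
  forall z : C, unit_disc z ->
    ex_derive (K := C_AbsRing) (V := C_NormedModule) g z.

Definition positive_definite (k : C -> C -> C) : Prop :=
  forall (N : nat) (z c : nat -> C), (forall i, unit_disc (z i)) ->
    let s := sum_n (fun i =>
               sum_n (fun j => Cconj (c i) * c j * k (z i) (z j)) N) N in
    Im s = 0%R /\ (0 <= Re s)%R.

Definition analytic_kernel (k : C -> C -> C) : Prop :=
  positive_definite k /\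
  forall w : C, unit_disc w -> analytic_on_disc (fun z => k z w).

(* Completeness is part of [CompleteNormedModule]; positivity and definiteness
   of [inner] follow from [inner_norm]. *)
Record HilbertSpace := {
  Hilbert_sort :> CompleteNormedModule C_AbsRing;
  inner : Hilbert_sort -> Hilbert_sort -> C;
  inner_plus_l : forall x y z, inner (plus x y) z = inner x z + inner y z;
  inner_scal_l : forall (c : C) x y, inner (scal c x) y = c * inner x y;
  inner_conj : forall x y, inner y x = Cconj (inner x y);
  inner_norm : forall x, inner x x = RtoC (norm x ^ 2)
}.

Arguments inner {h} _ _.

(* A Hilbert space of functions on the disc with reproducing kernel [k]:
   [ev h] is the function that the vector [h] is, and [ev_inj] says that
   vectors are determined by their functions. By the Moore-Aronszajn theorem
   such a space is unique up to an isometry preserving [ev]. *)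
Record RKHS (k : C -> C -> C) := {
  RKHS_sort :> HilbertSpace;
  ev : RKHS_sort -> C -> C;
  ev_plus : forall g h z, unit_disc z -> ev (plus g h) z = ev g z + ev h z;
  ev_scal : forall (c : C) h z, unit_disc z -> ev (scal c h) z = c * ev h z;
  ev_inj : forall g h, (forall z, unit_disc z -> ev g z = ev h z) -> g = h;
  ev_reproducing : forall w, unit_disc w ->
    exists kw : RKHS_sort,
      (forall z, unit_disc z -> ev kw z = k z w) /\
      (forall h, inner h kw = ev h w)
}.

Arguments ev {k r} _ _.

Definition contains_polynomials {k} (H : RKHS k) : Prop :=
  forall (N : nat) (p : nat -> C), exists h : H,
    forall z, unit_disc z -> ev h z = sum_n (fun i => p i * z ^ i) N.

Definition contained_in_analytic {k} (H : RKHS k) : Prop :=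
  forall h : H, analytic_on_disc (ev h).

Definition orthonormal_basis (H : HilbertSpace) (f : nat -> H) : Prop :=
  (forall n, inner (f n) (f n) = 1) /\
  (forall m n, m <> n -> inner (f m) (f n) = 0) /\
  (forall (h : H) (eps : posreal), exists (N : nat) (c : nat -> C),
     (norm (minus h (sum_n (fun i => scal (c i) (f i)) N)) < eps)%R).

Record semi_analytic_tridiagonal (k : C -> C -> C) (H : RKHS k)
    (a b : nat -> C) (f : nat -> H) : Prop := {
  sat_kernel : analytic_kernel k;
  sat_poly : contains_polynomials H;
  sat_analytic : contained_in_analytic H;
  sat_neq0 : forall n, a n <> 0;
  sat_sup : Rbar_lt (Sup_seq (fun n => Cmod (a n / a (S n)))) p_infty;
  sat_limsup : Rbar_lt (LimSup_seq (fun n => Cmod (b n / a (S n)))) 1%R;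
  sat_f : forall n z, unit_disc z -> ev (f n) z = (a n + b n * z) * z ^ n;
  sat_basis : orthonormal_basis H f
}.

Definition analytic_tridiagonal (k : C -> C -> C) (H : RKHS k)
    (a b : nat -> C) (f : nat -> H) : Prop :=
  semi_analytic_tridiagonal k H a b f /\
  exists c : R, (0 < c)%R /\ forall n, (c <= Cmod (a n / a (S n)))%R.

(* Only meaningful, and only used, for [1 <= n]. *)
Definition d (a b : nat -> C) (n : nat) : C :=
  b n / a n - b (Nat.pred n) / a (Nat.pred n).

(* [u s * u (s+1) * ... * u (s+l-1)] *)
Definition prod_from (u : nat -> C) (s l : nat) : C :=
  fold_right Cmult 1 (map u (seq s l)).

Definition ell (a b : nat -> C) (m n : nat) : C :=
  if Nat.eqb n (m + 1) then a (m + 1)%nat / a m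
  else if andb (Nat.eqb n m) (Nat.leb 1 m) then d a b m
  else if andb (Nat.leb 1 n) (Nat.ltb n m) then
    (- (1)) ^ (m - n) * (d a b n * prod_from b n (m - n))
      / prod_from a (n + 1) (m - n)
  else 0.

(* Main.v *)
Require Import Defs.
From Stdlib Require Import Reals Lra Lia.
From Coquelicot Require Import Coquelicot.

(** The matrix is split along its diagonals. For [j >= 0] the [j]-th lower
    diagonal is the generalised shift [D j] with
    [D j (f n) = ell (n + j) n * f (n + j)], and the superdiagonal is a weighted
    backward shift [B]. An operator [x |-> sum_i w_i <x, e_i> g_i] with
    [e] and [g] orthonormal sequences has norm at most [sup |w_i|]: by Bessel and
    Pythagoras the series converges in norm and is at most
    [sup |w_i| * norm x] ([weighted_operator_spec]). So [B] is bounded because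
    [a (n + 1) / a n] is, that is, because [|a n / a (n + 1)|] is bounded below.

    For the lower diagonals,
    [ell (n + j) n = (-1)^j * d n * prod_(n <= i < n + j) b i / a (i + 1)].
    Since [limsup |b i / a (i + 1)| < 1], all but finitely many factors of the
    product are at most some [r < 1], so the product is [O(r^j)] uniformly
    in [n]; and [d] is bounded because [b n / a n] is the quotient of the bounded
    [b n / a (n + 1)] by [a n / a (n + 1)], which is bounded below. So the
    entries of the [j]-th diagonal are at most [K * r^j] ([ell_geometric_bound]),
    hence [D j] has norm at most [K * r^j], and [sum_j D j] converges absolutely to a bounded operator
    ([is_linear_absolutely_convergent_series]). [L] is [B + sum_j D j]. Its
    entries are read off by exchanging the series with [<., f m>]: in each series
    that occurs at most one term is nonzero ([is_series_single]). *)

(** * Inner products and orthonormal sequences *)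

Section InnerProduct.
Context (H : HilbertSpace).
Implicit Types (x y z : H) (c : C) (N : nat).

Lemma inner_zero_l y : inner zero y = RtoC 0.
Proof.
assert (E : (zero : H) = scal (RtoC 0) (zero : H))
  by exact (eq_sym (scal_zero_l (zero : H))).
rewrite E, inner_scal_l; ring.
Qed.

Lemma inner_plus_r x y z : inner x (plus y z) = (inner x y + inner x z)%C.
Proof.
now rewrite inner_conj, inner_plus_l, Cplus_conj, <- !inner_conj.
Qed.

Lemma inner_scal_r c x y : inner x (scal c y) = (Cconj c * inner x y)%C.
Proof.
now rewrite inner_conj, inner_scal_l, Cmult_conj, <- inner_conj.
Qed.

Lemma inner_opp_l x y : inner (opp x) y = (- inner x y)%C.
Proof.
assert (E : opp x = scal (- RtoC 1)%C x) by exact (eq_sym (scal_opp_one x)).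
rewrite E, inner_scal_l; ring.
Qed.

Lemma inner_minus_l x y z : inner (minus x y) z = (inner x z - inner y z)%C.
Proof. unfold minus; rewrite inner_plus_l, inner_opp_l; ring. Qed.

Lemma inner_minus_r x y z : inner x (minus y z) = (inner x y - inner x z)%C.
Proof.
now rewrite inner_conj, inner_minus_l, Cminus_conj, <- !inner_conj.
Qed.

(** Compare [norm w >= 0] for the vector
    [w = |y|^2 x - <x, y> y], which is orthogonal to [y]. *)
Lemma cauchy_schwarz x y : Cmod (inner x y) <= norm x * norm y.
Proof.
pose (w := minus (scal (RtoC (norm y ^ 2)) x) (scal (inner x y) y)).
assert (Hw : norm w ^ 2
             = norm y ^ 2 * (norm y ^ 2 * norm x ^ 2 - Cmod (inner x y) ^ 2)).
{ apply RtoC_inj; rewrite <- inner_norm.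
  rewrite RtoC_mult, RtoC_minus, RtoC_mult, Cmod2_conj.
  unfold w; rewrite !inner_minus_l, !inner_minus_r, !inner_scal_l,
    !inner_scal_r, !inner_norm, (inner_conj _ x y).
  replace (Cconj (RtoC (norm y ^ 2))) with (RtoC (norm y ^ 2))
    by (apply injective_projections; simpl; ring).
  ring. }
pose proof (norm_ge_0 x); pose proof (norm_ge_0 y).
destruct (Rle_lt_or_eq_dec 0 (norm y) (norm_ge_0 y)) as [Hy | Hy].
- apply Rsqr_incr_0_var; [| nra].
  rewrite !Rsqr_pow2.
  assert (Hw0 : 0 <= norm w ^ 2) by apply pow2_ge_0.
  assert (0 < norm y ^ 2) by nra.
  rewrite Hw in Hw0.
  rewrite Rpow_mult_distr; nra.
- assert (Ey : y = zero) by exact (norm_eq_zero y (eq_sym Hy)).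
  rewrite Ey at 1; rewrite inner_conj, inner_zero_l, Cmod_conj, Cmod_0; nra.
Qed.

(** [C_NormedModule] and the module [C_AbsRing] over itself carry
    different uniform structures. The target here is the former, the one in which
    series of complex numbers are taken. *)
Lemma is_linear_inner_l y :
  is_linear (K := C_AbsRing) (V := C_NormedModule) (fun x : H => inner x y).
Proof.
split.
- intros u v; apply inner_plus_l.
- intros c u; apply inner_scal_l.
- exists (norm y + 1); split.
  + pose proof (norm_ge_0 y); lra.
  + intros x; eapply Rle_trans; [apply cauchy_schwarz |].
    pose proof (norm_ge_0 x); nra.
Qed.

Lemma is_series_inner_l (u : nat -> H) s y :
  is_series u s ->
  is_series (V := C_NormedModule) (fun i => inner (u i) y) (inner s y).
Proof.
intros Hu.
apply filterlim_ext with (fun N => inner (sum_n u N) y).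
- intros N; induction N as [| N IH].
  + now rewrite !sum_O.
  + now rewrite !sum_Sn, inner_plus_l, IH.
- refine (filterlim_comp _ _ _ _ (fun x => inner x y) _ _ _ Hu _).
  exact (linear_cont _ s (is_linear_inner_l y)).
Qed.

Definition orthonormal (e : nat -> H) : Prop :=
  (forall n, inner (e n) (e n) = RtoC 1) /\
  (forall m n, m <> n -> inner (e m) (e n) = RtoC 0).

Lemma inner_sum_orthogonal (u : nat -> H) y p q :
  (forall i, (i <= q)%nat -> inner (u i) y = RtoC 0) ->
  inner (sum_n_m u p q) y = RtoC 0.
Proof.
induction q as [| q IH]; intros Hu.
- destruct p as [| p].
  + rewrite sum_n_n; apply Hu; lia.
  + rewrite sum_n_m_zero by lia; apply inner_zero_l.
- destruct (Compare_dec.le_lt_dec p (S q)).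
  + rewrite sum_n_Sm, inner_plus_l, IH, Hu by (auto || lia); ring.
  + rewrite sum_n_m_zero by lia; apply inner_zero_l.
Qed.

(** Pythagoras, for arbitrary index ranges because the Cauchy criterion in
    [riesz_fischer] needs tails as well as partial sums. *)
Lemma norm_orthonormal_sum (e : nat -> H) (c : nat -> C) p q :
  orthonormal e ->
  norm (sum_n_m (fun i => scal (c i) (e i)) p q) ^ 2
  = sum_n_m (fun i => Cmod (c i) ^ 2) p q.
Proof.
intros [He1 He0].
assert (Hterm : forall i, norm (scal (c i) (e i)) ^ 2 = Cmod (c i) ^ 2).
{ intros i; apply RtoC_inj.
  rewrite <- inner_norm, inner_scal_l, inner_scal_r, He1, Cmod2_conj; ring. }
assert (Hempty : norm (zero : H) ^ 2 = 0).
{ assert (E : norm (zero : H) = 0) by exact norm_zero.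
  rewrite E; ring. }
induction q as [| q IH].
- destruct p as [| p].
  + now rewrite !sum_n_n.
  + rewrite !sum_n_m_zero by lia; exact Hempty.
- destruct (Compare_dec.le_lt_dec p (S q)).
  + rewrite !sum_n_Sm by lia; rewrite <- IH, <- Hterm.
    apply RtoC_inj; change (@plus R_AbelianMonoid) with Rplus.
    rewrite RtoC_plus, <- !inner_norm, !inner_plus_l, !inner_plus_r.
    assert (Hort : inner (sum_n_m (fun i => scal (c i) (e i)) p q)
                     (scal (c (S q)) (e (S q))) = RtoC 0).
    { apply inner_sum_orthogonal; intros i Hi.
      rewrite inner_scal_l, inner_scal_r, He0 by lia; ring. }
    rewrite (inner_conj _ _ (scal (c (S q)) (e (S q)))), Hort.
    apply injective_projections; simpl; ring.
  + rewrite !sum_n_m_zero by lia; exact Hempty.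
Qed.

(** With [s] the projection of [x] on the first vectors of [e] one has
    [<x, s> = |s|^2], so Cauchy-Schwarz gives [|s| <= |x|]. *)
Lemma bessel (e : nat -> H) x N :
  orthonormal e ->
  sum_n (fun i => Cmod (inner x (e i)) ^ 2) N <= norm x ^ 2.
Proof.
intros He.
pose (s := sum_n (fun i => scal (inner x (e i)) (e i)) N).
assert (Hs : norm s ^ 2 = sum_n (fun i => Cmod (inner x (e i)) ^ 2) N)
  by apply norm_orthonormal_sum, He.
assert (Hxs : inner x s = RtoC (norm s ^ 2)).
{ rewrite Hs; unfold s; clear.
  induction N as [| N IH].
  - now rewrite !sum_O, inner_scal_r, Cmod2_conj, Cmult_comm.
  - rewrite !sum_Sn, inner_plus_r, IH, inner_scal_r.
    change (@plus R_AbelianMonoid) with Rplus.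
    now rewrite RtoC_plus, Cmod2_conj, (Cmult_comm (Cconj _)). }
pose proof (cauchy_schwarz x s) as HCS.
rewrite Hxs, Cmod_R, Rabs_pos_eq in HCS by apply pow2_ge_0.
rewrite <- Hs.
pose proof (norm_ge_0 x); pose proof (norm_ge_0 s); nra.
Qed.

End InnerProduct.

(** * Operators defined by series *)

Section Operators.
Context (H : HilbertSpace).
Implicit Types (x y z : H) (e g : nat -> H).

Lemma norm_is_series_le (u : nat -> H) s B :
  is_series u s -> (forall N, norm (sum_n u N) <= B) -> norm s <= B.
Proof.
intros Hu HB.
apply (is_lim_seq_le (fun N => norm (sum_n u N)) (fun _ => B) (norm s) B HB).
- exact (filterlim_comp _ _ _ _ norm _ _ _ Hu (filterlim_norm s)).
- apply is_lim_seq_const.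
Qed.

(** By Pythagoras the tails of the series have the norms of the tails of
    [sum |c i|^2]; completeness does the rest. *)
Lemma riesz_fischer g (c : nat -> C) B :
  orthonormal H g -> (forall N, sum_n (fun i => Cmod (c i) ^ 2) N <= B) ->
  ex_series (fun i => scal (c i) (g i)).
Proof.
intros Hg HB.
assert (Hc : ex_series (fun i => Cmod (c i) ^ 2)).
{ destruct (ex_finite_lim_seq_incr (sum_n (fun i => Cmod (c i) ^ 2)) B)
    as [l Hl]; [| exact HB | exists l; exact Hl].
  intros n; rewrite sum_Sn; change (@plus R_AbelianMonoid) with Rplus.
  pose proof (pow2_ge_0 (Cmod (c (S n)))); lra. }
apply ex_series_Cauchy; intros eps.
destruct (Cauchy_ex_series _ Hc (mkposreal _ (pow_lt eps 2 (cond_pos eps))))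
  as [N HN].
exists N; intros n m Hn Hm.
assert (Hnm : sum_n_m (fun i => Cmod (c i) ^ 2) n m < eps ^ 2)
  by exact (Rle_lt_trans _ _ _ (Rle_abs _) (HN n m Hn Hm)).
rewrite <- (norm_orthonormal_sum H g c n m Hg) in Hnm.
pose proof (cond_pos eps).
apply Rsqr_incrst_0; [| apply norm_ge_0 | lra].
rewrite !Rsqr_pow2; exact Hnm.
Qed.

(** Limits are unique, so [iota] picks the sum without any choice principle. *)
Definition pointwise_series (u : nat -> H -> H) x : H :=
  iota (fun s : H => is_series (fun j => u j x) s).

Lemma pointwise_series_correct (u : nat -> H -> H) x :
  ex_series (fun j => u j x) ->
  is_series (fun j => u j x) (pointwise_series u x).
Proof.
intros [s Hs]; unfold pointwise_series; apply iota_correct.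
exists s; split; [exact Hs |].
intros s' Hs'; exact (filterlim_locally_unique _ _ _ Hs Hs').
Qed.

Lemma is_linear_pointwise_series (u : nat -> H -> H) M :
  (forall j, is_linear (u j)) ->
  (forall x, ex_series (fun j => u j x)) ->
  (forall x N, norm (sum_n (fun j => u j x) N) <= M * norm x) ->
  is_linear (pointwise_series u) /\
  (forall x, norm (pointwise_series u x) <= M * norm x).
Proof.
intros Hlin Hex HM.
pose (T := pointwise_series u).
assert (HT : forall x, is_series (fun j => u j x) (T x))
  by (intros x; apply pointwise_series_correct, Hex).
fold T.
assert (Hbound : forall x, norm (T x) <= M * norm x).
{ intros x; apply norm_is_series_le with (1 := HT x); auto. }
split; [split | exact Hbound].
- intros x y.
  apply (filterlim_locally_unique _ _ _ (HT (plus x y))).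
  apply (is_series_ext (fun j => plus (u j x) (u j y))).
  + intros j; symmetry; exact (linear_plus _ (Hlin j) x y).
  + exact (is_series_plus _ _ _ _ (HT x) (HT y)).
- intros c x.
  apply (filterlim_locally_unique _ _ _ (HT (scal c x))).
  apply (is_series_ext (fun j => scal c (u j x))).
  + intros j; symmetry; exact (linear_scal _ (Hlin j) c x).
  + exact (is_series_scal c _ _ (HT x)).
- exists (Rabs M + 1); split; [pose proof (Rabs_pos M); lra |].
  intros x; eapply Rle_trans; [apply Hbound |].
  apply Rmult_le_compat_r; [apply norm_ge_0 |].
  pose proof (Rle_abs M); lra.
Qed.

(** Absolute convergence in operator norm, stated pointwise: the series of norm
    bounds [M] dominates the series at every vector. *)
Lemma is_linear_absolutely_convergent_series
    (u : nat -> H -> H) (M : nat -> R) (s : R) :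
  (forall j, 0 <= M j) -> is_series M s ->
  (forall j, is_linear (u j)) ->
  (forall j x, norm (u j x) <= M j * norm x) ->
  is_linear (pointwise_series u) /\
  (forall x, is_series (fun j => u j x) (pointwise_series u x)).
Proof.
intros HM0 HM Hlin Hu.
assert (Hex : forall x, ex_series (fun j => u j x)).
{ intros x; apply (ex_series_le (V := H) _ (fun j => M j * norm x)); [auto |].
  apply ex_series_scal_r; exists s; exact HM. }
split; [| intros x; exact (pointwise_series_correct u x (Hex x))].
apply (is_linear_pointwise_series u s); auto.
intros x N.
apply Rle_trans with (sum_n (fun j => M j * norm x) N).
- eapply Rle_trans; [exact (norm_sum_n_m _ 0 N) |].
  apply sum_n_m_le; auto.
- rewrite (sum_n_mult_r (K := R_Ring)).
  apply Rmult_le_compat_r; [apply norm_ge_0 |].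
  refine (is_lim_seq_incr_compare (sum_n M) s HM _ N).
  intros j; rewrite sum_Sn; change (@plus R_AbelianMonoid) with Rplus.
  specialize (HM0 (S j)); lra.
Qed.

(** The terms of a [weighted_operator]. *)
Lemma is_linear_rank_one (c : C) y z :
  is_linear (fun x : H => scal (c * inner x y)%C z).
Proof.
split.
- intros x x'; rewrite inner_plus_l, Cmult_plus_distr_l.
  exact (scal_distr_r _ _ z).
- intros r x; rewrite inner_scal_l.
  replace (c * (r * inner x y))%C with (r * (c * inner x y))%C by ring.
  exact (eq_sym (scal_assoc r (c * inner x y)%C z)).
- assert (HM : 0 <= Cmod c * norm y * norm z)
    by (repeat apply Rmult_le_pos; auto using Cmod_ge_0, norm_ge_0).
  exists (Cmod c * norm y * norm z + 1); split; [lra |].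
  intros x; eapply Rle_trans; [exact (norm_scal (c * inner x y)%C z) |].
  change (@abs C_AbsRing) with Cmod; rewrite Cmod_mult.
  apply Rle_trans with (Cmod c * norm y * norm z * norm x);
    [| pose proof (norm_ge_0 x); nra].
  replace (Cmod c * norm y * norm z * norm x)
    with (Cmod c * (norm x * norm y) * norm z) by ring.
  apply Rmult_le_compat_r; [apply norm_ge_0 |].
  apply Rmult_le_compat_l; [apply Cmod_ge_0 | apply cauchy_schwarz].
Qed.

(** The partial isometry from the closed span of [e] to that of [g], twisted by the
    weights [w]; shifts are obtained from [e] and [g] being the same sequence with
    different offsets. *)
Definition weighted_operator e g (w : nat -> C) : H -> H :=
  pointwise_series (fun i x => scal (w i * inner x (e i))%C (g i)).

(** The coefficients [w i * <x, e i>] are square summable by Bessel, with sum of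
    squares at most [(M * |x|)^2]. *)
Lemma weighted_operator_spec e g (w : nat -> C) M :
  orthonormal H e -> orthonormal H g -> (forall i, Cmod (w i) <= M) ->
  is_linear (weighted_operator e g w) /\
  (forall x, norm (weighted_operator e g w x) <= M * norm x) /\
  (forall x, is_series (fun i => scal (w i * inner x (e i))%C (g i))
               (weighted_operator e g w x)).
Proof.
intros He Hg Hw.
assert (HM : 0 <= M) by (eapply Rle_trans; [apply Cmod_ge_0 | apply (Hw O)]).
assert (Hsum : forall x N, sum_n (fun i => Cmod (w i * inner x (e i)) ^ 2) N
                           <= (M * norm x) ^ 2).
{ intros x N.
  apply Rle_trans with (M ^ 2 * sum_n (fun i => Cmod (inner x (e i)) ^ 2) N).
  - rewrite <- (sum_n_mult_l (K := R_Ring)).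
    apply sum_n_m_le; intros i; rewrite Cmod_mult, Rpow_mult_distr.
    apply Rmult_le_compat_r; [apply pow2_ge_0 |].
    apply pow_incr; split; [apply Cmod_ge_0 | apply Hw].
  - rewrite Rpow_mult_distr; apply Rmult_le_compat_l; [apply pow2_ge_0 |].
    apply bessel, He. }
assert (Hex : forall x, ex_series (fun i => scal (w i * inner x (e i))%C (g i)))
  by (intros x; apply riesz_fischer with (1 := Hg) (2 := Hsum x)).
assert (Hlin : is_linear (weighted_operator e g w) /\
  (forall x, norm (weighted_operator e g w x) <= M * norm x)).
{ apply is_linear_pointwise_series; [| exact Hex |].
  - intros i; apply is_linear_rank_one.
  - intros x N.
    apply Rsqr_incr_0_var; [| pose proof (norm_ge_0 x); nra].
    rewrite !Rsqr_pow2; unfold sum_n.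
    rewrite (norm_orthonormal_sum H g _ 0 N Hg); apply Hsum. }
split; [apply Hlin | split; [apply Hlin |]].
intros x; exact (pointwise_series_correct _ x (Hex x)).
Qed.

End Operators.

(** * Complex series and products *)

Lemma is_series_single (u : nat -> C) (s : C) k :
  is_series (V := C_NormedModule) u s ->
  (forall i, i <> k -> u i = RtoC 0) -> s = u k.
Proof.
intros Hs Hu.
assert (Hsum : forall N, @eq C (sum_n u N) (if Nat.leb k N then u k else RtoC 0)).
{ induction N as [| N IH].
  - rewrite sum_O; destruct k; [easy | now apply Hu].
  - rewrite sum_Sn, IH; change (@plus C_AbelianMonoid) with Cplus.
    destruct (Nat.leb_spec k N), (Nat.leb_spec k (S N)); try lia.
    + rewrite (Hu (S N)) by lia; ring.
    + replace (S N) with k by lia; ring.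
    + rewrite (Hu (S N)) by lia; ring. }
apply (filterlim_locally_unique (V := C_NormedModule) _ _ _ Hs).
apply (filterlim_ext_loc (fun _ => u k)); [| apply filterlim_const].
exists k; intros N HN; rewrite Hsum.
now destruct (Nat.leb_spec k N); [| lia].
Qed.

Lemma prod_from_S (u : nat -> C) s l :
  prod_from u s (S l) = (u s * prod_from u (S s) l)%C.
Proof. reflexivity. Qed.

Lemma prod_from_shift (u : nat -> C) s l :
  prod_from (fun i => u (S i)) s l = prod_from u (S s) l.
Proof.
revert s; induction l as [| l IH]; intros s; [reflexivity |].
now rewrite !prod_from_S, IH.
Qed.

Lemma prod_from_neq0 (u : nat -> C) s l :
  (forall i, u i <> RtoC 0) -> prod_from u s l <> RtoC 0.
Proof.
intros Hu; revert s; induction l as [| l IH]; intros s.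
- exact C1_nz.
- now rewrite prod_from_S; apply Cmult_neq_0.
Qed.

Lemma prod_from_div (u v : nat -> C) s l :
  (forall i, v i <> RtoC 0) ->
  prod_from (fun i => u i / v i)%C s l = (prod_from u s l / prod_from v s l)%C.
Proof.
intros Hv; revert s; induction l as [| l IH]; intros s.
- unfold prod_from; simpl; field; exact C1_nz.
- rewrite !prod_from_S, IH; field; split; [apply prod_from_neq0 |]; auto.
Qed.

(** The finitely many factors exceeding [r] only cost a constant, the same for all
    starting points. Induction on their number [N]: products starting after the
    first factor [u 0] are products of the shifted sequence, and a nonempty product
    that contains [u 0] costs an additional [|u 0| / r]. *)
Lemma prod_from_geometric_eventually (r : R) N (u : nat -> C) :
  0 < r -> (forall n, (N <= n)%nat -> Cmod (u n) <= r) ->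
  exists K, 0 <= K /\ forall s l, Cmod (prod_from u s l) <= K * r ^ l.
Proof.
intros Hr; revert u; induction N as [| N IH]; intros u Hu.
- exists 1; split; [lra |].
  intros s l; revert s; induction l as [| l IHl]; intros s.
  + unfold prod_from; simpl; rewrite Cmod_1; lra.
  + rewrite prod_from_S, Cmod_mult; specialize (IHl (S s)).
    assert (Hs := Hu s (Nat.le_0_l s)).
    replace (1 * r ^ S l) with (r * (1 * r ^ l)) by (simpl; ring).
    apply Rmult_le_compat; auto using Cmod_ge_0.
- destruct (IH (fun i => u (S i))) as [K [HK0 HK]].
  { intros n Hn; apply Hu; lia. }
  assert (H0 : 0 <= Cmod (u O) / r * K).
  { apply Rmult_le_pos; [| lra].
    apply Rdiv_le_0_compat; [apply Cmod_ge_0 | lra]. }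
  exists (1 + K + Cmod (u O) / r * K); split; [lra |].
  intros s l.
  assert (Hl : 0 < r ^ l) by now apply pow_lt.
  destruct s as [| s].
  + destruct l as [| l].
    * unfold prod_from; simpl; rewrite Cmod_1; lra.
    * rewrite prod_from_S, <- prod_from_shift, Cmod_mult.
      apply Rle_trans with (Cmod (u O) / r * K * r ^ S l); [| nra].
      replace (Cmod (u O) / r * K * r ^ S l)
        with (Cmod (u O) * (K * r ^ l)) by (simpl; field; lra).
      apply Rmult_le_compat_l; [apply Cmod_ge_0 | apply HK].
  + rewrite <- prod_from_shift.
    apply Rle_trans with (1 := HK s l); nra.
Qed.

Lemma limsup_lt_eventually (u : nat -> R) (l : R) :
  Rbar_lt (LimSup_seq u) l ->
  exists r N, r < l /\ forall n, (N <= n)%nat -> u n <= r.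
Proof.
unfold LimSup_seq; destruct (ex_LimSup_seq u) as [[s | |] Hs]; simpl;
  intros Hlt; try easy.
- assert (Heps : 0 < (l - s) / 2) by lra.
  destruct (Hs (mkposreal _ Heps)) as [_ [N HN]]; simpl in HN.
  exists ((s + l) / 2), N; split; [lra |].
  intros n Hn; specialize (HN n Hn); lra.
- destruct (Hs (l - 1)) as [N HN].
  exists (l - 1), N; split; [lra |].
  intros n Hn; specialize (HN n Hn); lra.
Qed.

(** * The diagonals of the matrix *)

Section Entries.
Context (a b : nat -> C) (Ha : forall n, a n <> RtoC 0).

(** One formula for the main diagonal ([j = 0], empty product) and everything
    below it. *)
Lemma ell_lower n j : (1 <= n)%nat ->
  ell a b (n + j) n
  = ((- (1)) ^ j * (d a b n * prod_from (fun i => b i / a (S i)) n j))%C.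
Proof.
intros Hn.
rewrite prod_from_div, prod_from_shift by auto.
assert (Hp := prod_from_neq0 a (S n) j Ha).
unfold ell.
destruct (Nat.eqb_spec n (n + j + 1)); [lia |].
destruct (Nat.eqb_spec n (n + j)).
- replace j with O by lia; rewrite Nat.add_0_r.
  destruct (Nat.leb_spec 1 n); [| lia]; simpl.
  unfold prod_from; simpl; field; exact C1_nz.
- destruct (Nat.leb_spec 1 n), (Nat.ltb_spec n (n + j)); try lia; simpl andb.
  cbv iota.
  replace (n + j - n)%nat with j by lia; replace (n + 1)%nat with (S n) by lia.
  field; exact Hp.
Qed.

Lemma ell_lower_0 j : ell a b j 0 = RtoC 0.
Proof.
unfold ell; destruct j as [| j]; [reflexivity |].
now rewrite Nat.add_comm.
Qed.

Lemma ell_super m : ell a b m (S m) = (a (S m) / a m)%C.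
Proof.
now unfold ell; rewrite Nat.add_1_r, Nat.eqb_refl.
Qed.

Lemma ell_far m n : (S m < n)%nat -> ell a b m n = RtoC 0.
Proof.
intros Hmn; unfold ell.
destruct (Nat.eqb_spec n (m + 1)), (Nat.eqb_spec n m), (Nat.ltb_spec n m);
  try lia.
now rewrite Bool.andb_false_r.
Qed.

(** The bound is uniform along each diagonal, so that it bounds operator norms and
    makes the diagonals summable. *)
Lemma ell_geometric_bound c :
  0 < c -> (forall n, c <= Cmod (a n / a (S n))%C) ->
  Rbar_lt (LimSup_seq (fun n => Cmod (b n / a (S n))%C)) 1%R ->
  exists K r, 0 < r < 1 /\
    forall n j, Cmod (ell a b (n + j) n) <= K * r ^ j.
Proof.
intros Hc Hac Hlim.
destruct (limsup_lt_eventually _ _ Hlim) as [r0 [N [Hr0 HN]]].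
(* [r0] may be negative, while the geometric bounds divide by [r]. *)
pose (r := Rmax r0 (1 / 2)).
assert (Hr : 0 < r < 1).
{ unfold r; split; [apply Rlt_le_trans with (1 / 2); [lra | apply Rmax_r] |].
  apply Rmax_lub_lt; lra. }
destruct (prod_from_geometric_eventually r N (fun i => b i / a (S i))%C)
  as [K [HK0 HK]]; [apply Hr | |].
{ intros n Hn; apply Rle_trans with r0; [now apply HN | apply Rmax_l]. }
assert (Hdiag : forall n, Cmod (b n / a n)%C <= K * r / c).
{ intros n.
  replace (b n / a n)%C with ((b n / a (S n)) / (a n / a (S n)))%C
    by (field; auto).
  assert (Hq : (a n / a (S n))%C <> RtoC 0)
    by (intros E; specialize (Hac n); rewrite E, Cmod_0 in Hac; lra).
  rewrite Cmod_div by exact Hq.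
  specialize (HK n 1%nat); unfold prod_from in HK; simpl in HK.
  rewrite Cmult_1_r, Rmult_1_r in HK.
  apply Rmult_le_compat; auto using Cmod_ge_0.
  - apply Rlt_le, Rinv_0_lt_compat; specialize (Hac n); lra.
  - apply Rinv_le_contravar; auto. }
revert Hdiag; generalize (K * r / c); intros Q Hdiag.
exists (2 * Q * K), r; split; [exact Hr |].
assert (HQ : 0 <= Q)
  by (eapply Rle_trans; [apply Cmod_ge_0 | apply (Hdiag O)]).
intros n j; assert (Hj : 0 < r ^ j) by now apply pow_lt.
destruct n as [| n].
- rewrite ell_lower_0, Cmod_0.
  repeat apply Rmult_le_pos; lra.
- rewrite ell_lower by lia.
  rewrite !Cmod_mult, Cmod_pow, Cmod_opp, Cmod_1, pow1, Rmult_1_l, Rmult_assoc.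
  apply Rmult_le_compat; auto using Cmod_ge_0.
  unfold d, Cminus; eapply Rle_trans; [apply Cmod_triangle |].
  rewrite Cmod_opp.
  pose proof (Hdiag (S n)); pose proof (Hdiag (Nat.pred (S n))); lra.
Qed.

End Entries.

(** * The operator *)

Theorem proposition3p1 (k : C -> C -> C) (H : RKHS k) (a b : nat -> C)
    (f : nat -> H) (hk : analytic_tridiagonal k H a b f) :
  exists L : H -> H,
    is_linear (K := C_AbsRing) L /\
    forall m n : nat, inner (L (f n)) (f m) = ell a b m n.
Proof.
destruct hk as [[_ _ _ Ha _ Hlim _ [Hf1 [Hf0 _]]] [c [Hc Hac]]].
assert (Hf : forall j, orthonormal H (fun i => f (i + j)%nat)).
{ intros j; split; [intros n; apply Hf1 | intros m n Hmn; apply Hf0; lia]. }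
destruct (ell_geometric_bound a b Ha c Hc Hac Hlim) as [K [r [Hr HK]]].
(* All sequences are written [f (i + offset)], so that [Hf] applies to each. *)
pose (B := weighted_operator H (fun i => f (i + 1)%nat) (fun i => f (i + 0)%nat)
             (fun i => a (S i) / a i)%C).
pose (D j := weighted_operator H (fun i => f (i + 0)%nat)
               (fun i => f (i + j)%nat) (fun i => ell a b (i + j) i)).
destruct (weighted_operator_spec H _ _ (fun i => a (S i) / a i)%C (/ c)
            (Hf 1%nat) (Hf 0%nat)) as [HB [_ HBs]].
{ intros i.
  replace (a (S i) / a i)%C with (/ (a i / a (S i)))%C by (field; auto).
  rewrite Cmod_inv
    by (intros E; specialize (Hac i); rewrite E, Cmod_0 in Hac; lra).
  apply Rinv_le_contravar; auto. }
fold B in HB, HBs.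
assert (HD : forall j, is_linear (D j) /\
  (forall x, norm (D j x) <= K * r ^ j * norm x) /\
  (forall x, is_series
       (fun i => scal (ell a b (i + j) i * inner x (f (i + 0)%nat))%C
                   (f (i + j)%nat)) (D j x))).
{ intros j; apply (weighted_operator_spec H _ _ (fun i => ell a b (i + j) i));
    auto. }
assert (Hgeom : is_series (fun j => K * r ^ j) (K * / (1 - r))).
{ apply (is_series_scal (K := R_AbsRing) (V := R_NormedModule) K).
  apply is_series_geom; rewrite Rabs_pos_eq; lra. }
assert (HK0 : forall j, 0 <= K * r ^ j)
  by (intros j; eapply Rle_trans; [apply Cmod_ge_0 | apply (HK O)]).
destruct (is_linear_absolutely_convergent_series H D _ _ HK0 Hgeom) as [HT HTs];
  [apply HD | apply HD |].
exists (fun x => plus (B x) (pointwise_series H D x)); split.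
{ exact (is_linear_comp _ _ (is_linear_prod _ _ HB HT) is_linear_plus). }
intros m n.
rewrite inner_plus_l.
assert (HBmn : inner (B (f n)) (f m)
               = (a (S m) / a m * inner (f n) (f (S m)))%C).
{ etransitivity; [refine (is_series_single _ _ m
    (is_series_inner_l H _ _ (f m) (HBs (f n))) _) |].
  - intros i Hi; rewrite inner_scal_l, (Hf0 (i + 0)%nat m) by lia; ring.
  - simpl; rewrite inner_scal_l, Nat.add_0_r, Nat.add_1_r, Hf1; ring. }
assert (HDmn : forall j, inner (D j (f n)) (f m)
               = (ell a b (n + j) n * inner (f (n + j)%nat) (f m))%C).
{ intros j; etransitivity; [refine (is_series_single _ _ n
    (is_series_inner_l H _ _ (f m) (proj2 (proj2 (HD j)) (f n))) _) |].
  - intros i Hi; rewrite inner_scal_l, (Hf0 n (i + 0)%nat) by lia; ring.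
  - simpl; rewrite inner_scal_l, Nat.add_0_r, Hf1; ring. }
(* The diagonal through [(m, n)] has index [m - n]. If [m < n] this truncates
   to [0]; the term is then a multiple of [<f n, f m> = 0], as it should be. *)
assert (HTmn : inner (pointwise_series H D (f n)) (f m)
               = (ell a b (n + (m - n)) n * inner (f (n + (m - n))%nat) (f m))%C).
{ rewrite <- HDmn.
  refine (is_series_single _ _ (m - n)
    (is_series_inner_l H _ _ (f m) (HTs (f n))) _).
  intros j Hj; rewrite HDmn.
  destruct (Nat.eq_dec (n + j) m); [lia |].
  rewrite (Hf0 (n + j)%nat m) by lia; ring. }
rewrite HBmn, HTmn.
destruct (Compare_dec.lt_eq_lt_dec n (S m)) as [[Hn | ->] | Hn].
- rewrite (Hf0 n (S m)) by lia.
  replace (n + (m - n))%nat with m by lia; rewrite Hf1; ring.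
- rewrite ell_super, Hf1, (Hf0 (S m + (m - S m))%nat m) by lia; ring.
- rewrite (ell_far a b m n), (Hf0 n (S m)), (Hf0 (n + (m - n))%nat m) by lia; ring.
Qed.
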